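(* Let $I \subset \mathbb{R}$ be an interval and let $x_0 \in I$. (a) (Right-sided version, where $x_0 \neq \sup I$.) The family of all quasi-arithmetic means $A^{[f]}$ generated by continuous, strictly monotone functions $f \colon I \to \mathbb{R}$ that are right-sided differentiable at $x_0$ with $f'_+(x_0) \neq 0$ is an interval-type set in the family of all quasi-arithmetic means on $I$. (b) (Left-sided version, where $x_0 \neq \inf I$.) The family of all quasi-arithmetic means $A^{[f]}$ generated by continuous, strictly monotone functions $f \colon I \to \mathbb{R}$ that are left-sided differentiable at $x_0$ with $f'_-(x_0) \neq 0$ is an interval-type set in the family of all quasi-arithmetic means on $I$.
   Context: For an interval $I\subset\mathbb{R}$ and a continuous, strictly monotone function $f \colon I \to \mathbb{R}$, the quasi-arithmetic mean generated by $f$ is the function $A^{[f]} \colon \bigcup_{n=1}^\infty I^n \to I$, $A^{[f]}(a_1,\dots,a_n) := f^{-1}\left(\frac{f(a_1)+\cdots+f(a_n)}{n}\right)$. For two such functions $f,g$ on the same interval $I$, $A^{[f]} \le A^{[g]}$ means $A^{[f]}(a) \le A^{[g]}(a)$ for all $a \in \bigcup_{n=1}^\infty I^n$. A set $\mathcal{I}$ of quasi-arithmetic means on $I$ is called an interval-type set (or interval) if, whenever $A^{[f]}, A^{[g]} \in \mathcal{I}$ and $A^{[h]}$ is a quasi-arithmetic mean on $I$ with $A^{[f]} \le A^{[h]} \le A^{[g]}$, then $A^{[h]} \in \mathcal{I}$. Here $f'_+(x_0)$, $f'_-(x_0)$ denote the right and left derivatives, and one-sided differentiability means that the corresponding derivative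 exists as a finite number. *)

(* Defs.v *)
From HB Require Import structures.
From mathcomp Require Import all_boot all_order all_algebra.
From mathcomp Require Import all_classical all_reals all_analysis.

Set Implicit Arguments.
Unset Strict Implicit.
Unset Printing Implicit Defensive.

Import Order.TTheory GRing.Theory Num.Theory.
Import numFieldNormedType.Exports.

Local Open Scope classical_set_scope.
Local Open Scope ring_scope.

Definition strictly_monotone_on (R : realType) (I : set R) (f : R -> R) : Prop :=
  {in I &, {homo f : x y / x < y}} \/ {in I &, {homo f : x y /~ x < y}}.

(** A function [I -> R] is represented by a total [f : R -> R] of which only
    the restriction to [I] matters. *)
Definition generator (R : realType) (I : set R) (f : R -> R) : Prop :=
  {within I, continuous f} /\ strictly_monotone_on I f.

(** Functions from the union of the [I ^ m], [m >= 1], to [I]; the length [m]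
    is [n.+1]. *)
Definition mean (R : realType) (I : set R) : Type :=
  forall n : nat, n.+1.-tuple I -> I.

(** [f^-1] is the partial inverse of the restriction of [f] to [I]. The default
    [thead a] is used only off the range of that restriction; [qa_meanE] shows
    that this never happens for a generator on an interval. *)
Definition qa_mean (R : realType) (I : set R) (f : R -> R) : mean I :=
  fun n a => 'pinv_(fun=> thead a) [set: I] (f \o set_val)
    ((\sum_(i < n.+1) f (set_val (tnth a i))) / n.+1%:R).

Lemma qa_meanE (R : realType) (I : set R) (f : R -> R) (n : nat)
    (a : n.+1.-tuple I) : is_interval I -> generator I f ->
  f (set_val (qa_mean f a)) =
  (\sum_(i < n.+1) f (set_val (tnth a i))) / n.+1%:R.
Proof.
move=> Iitv [fC _]; pose F i := f (set_val (tnth a i)).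
suff yP : ((\sum_i F i) / n.+1%:R) \in (f \o set_val) @` [set: I].
  exact: (pinvK (fun=> thead a) yP).
have [m _ mP] := @arg_minP _ _ _ ord0 xpredT F isT.
have [M _ MP] := @arg_maxP _ _ _ ord0 xpredT F isT.
have n0 : (0 : R) < n.+1%:R by rewrite ltr0n.
have lo : F m <= (\sum_i F i) / n.+1%:R.
  rewrite ler_pdivlMr// mulr_natr -[X in _ *+ X](card_ord n.+1) -sumr_const.
  by apply: ler_sum => i _; apply: mP.
have hi : (\sum_i F i) / n.+1%:R <= F M.
  rewrite ler_pdivrMr// mulr_natr -[X in _ *+ X](card_ord n.+1) -sumr_const.
  by apply: ler_sum => i _; apply: MP.
have Iu i : I (set_val (tnth a i)) by apply/set_mem/valP.
have key u v y : I u -> I v -> u <= v ->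
    Num.min (f u) (f v) <= y <= Num.max (f u) (f v) ->
    y \in (f \o set_val) @` [set: I].
  move=> Iuu Iv uv yuv; have sub : `[u, v] `<=` I.
    by move=> z /=; rewrite in_itv/=; apply: Iitv.
  have [c cuv <-] := IVT uv (continuous_subspaceW sub fC) yuv.
  by apply/mem_set; exists (SigSub (mem_set (sub _ cuv))).
have [uv|/ltW uv] := leP (set_val (tnth a m)) (set_val (tnth a M)).
- apply: (key _ _ _ (Iu m) (Iu M) uv); rewrite ge_min le_max.
  by rewrite -/(F m) -/(F M) lo hi orbT.
- apply: (key _ _ _ (Iu M) (Iu m) uv); rewrite ge_min le_max.
  by rewrite -/(F m) -/(F M) lo hi orbT.
Qed.

Definition mean_le (R : realType) (I : set R) (A B : mean I) : Prop :=
  forall (n : nat) (a : n.+1.-tuple I), set_val (A n a) <= set_val (B n a).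

Definition qa_means (R : realType) (I : set R) : set (mean I) :=
  [set A | exists2 f, generator I f & A = qa_mean f].

Arguments qa_means {R} I _.

Definition interval_type (R : realType) (I : set R) (F : set (mean I)) : Prop :=
  F `<=` qa_means I /\
  forall A B M : mean I, F A -> F B -> qa_means I M ->
    mean_le A M -> mean_le M B -> F M.

Definition right_derivable (R : realType) (f : R -> R) (x : R) : Prop :=
  cvg (h^-1 * (f (x + h) - f x) @[h --> 0^'+]).

Definition right_derive (R : realType) (f : R -> R) (x : R) : R :=
  lim (h^-1 * (f (x + h) - f x) @[h --> 0^'+]).

Definition left_derivable (R : realType) (f : R -> R) (x : R) : Prop :=
  cvg (h^-1 * (f (x + h) - f x) @[h --> 0^'-]).

Definition left_derive (R : realType) (f : R -> R) (x : R) : R :=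
  lim (h^-1 * (f (x + h) - f x) @[h --> 0^'-]).

Definition right_smooth_means (R : realType) (I : set R) (x0 : R) :
    set (mean I) :=
  [set A | exists f, [/\ generator I f, right_derivable f x0,
     right_derive f x0 != 0 & A = qa_mean f]].

Arguments right_smooth_means {R} I x0 _.

Definition left_smooth_means (R : realType) (I : set R) (x0 : R) :
    set (mean I) :=
  [set A | exists f, [/\ generator I f, left_derivable f x0,
     left_derive f x0 != 0 & A = qa_mean f]].

Arguments left_smooth_means {R} I x0 _.

(* Main.v *)
Require Import Defs.
From mathcomp Require Import all_boot all_order all_algebra.
From mathcomp Require Import all_classical all_reals all_analysis.
From mathcomp Require Import ring lra.

Set Implicit Arguments.
Unset Strict Implicit.
Unset Printing Implicit Defensive.

Import Order.TTheory GRing.Theory Num.Theory.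
Import numFieldNormedType.Exports.

Local Open Scope classical_set_scope.
Local Open Scope ring_scope.

(** Take increasing generators [f], [h], [g] of three means with
    [A^f <= A^h <= A^g]. Comparing the means on samples made of copies of [x0]
    and [z] only shows that [h \o f^-1] is convex on chords starting at [f x0],
    first for rational weights and then, by monotonicity, for all of them.
    On the right of [x0] the ratio [(h y - h x0) / (f y - f x0)] is therefore
    nonincreasing and nonnegative as [y] decreases to [x0], so it has a finite
    limit [l]; likewise [(g y - g x0) / (h y - h x0)] has a finite limit [l'].
    Hence [h'_+ = l f'_+] exists, and [g'_+ = l' h'_+ != 0] forces
    [h'_+ != 0]. On the left of [x0] the inverse ratios are the ones that
    converge, so [f] and [g] exchange their roles. *)

(** * Ratios and slopes at 0 from the right *)

Lemma fraction_between (R : realType) (s t : R) : 0 <= s -> s < t -> t <= 1 ->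
  exists k n : nat, (k <= n.+1)%N /\ s < k%:R / n.+1%:R < t.
Proof.
(* This [n] puts [s * n.+1%:R] and [t * n.+1%:R] more than 1 apart, so the first integer [k] above
   the former lies below the latter. *)
move=> s0 st t1; pose n := Num.truncn (t - s)^-1.
pose k := (Num.truncn (s * n.+1%:R)).+1.
have n0 : (0 : R) < n.+1%:R by rewrite ltr0n.
have sk : s * n.+1%:R < k%:R by exact: truncnS_gt.
have kt : k%:R < t * n.+1%:R.
  have : 1 < (t - s) * n.+1%:R.
    by rewrite -ltr_pdivrMl ?subr_gt0// mulr1 truncnS_gt.
  have /andP[+ _] := truncn_itv (mulr_ge0 s0 (ltW n0)).
  by rewrite /k -(natr1 (Num.truncn _)); lra.
exists k, n; rewrite ltr_pdivlMr// ltr_pdivrMr// sk kt; split=> //.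
by rewrite -(ler_nat R) (le_trans (ltW kt))// ler_piMl// ltW.
Qed.

Section RatioLimit.
Context {R : realType} (J : set R) (b : R) (u v : R -> R).
Hypotheses (b0 : 0 < b) (bJ : [set` `[0, b]] `<=` J).
Hypotheses (u_incr : {in J &, {homo u : x y / x < y}}) (u0 : u 0 = 0).
Hypotheses (v_incr : {in J &, {homo v : x y / x < y}}) (v0 : v 0 = 0).

Let inJ y : 0 <= y -> y <= b -> y \in J.
Proof. by move=> y0 yb; apply/mem_set/bJ; rewrite /= in_itv/= y0. Qed.

Let u_gt0 y : 0 < y -> y <= b -> 0 < u y.
Proof. by move=> y0 yb; rewrite -u0 u_incr// inJ// ltW. Qed.

Let v_gt0 y : 0 < y -> y <= b -> 0 < v y.
Proof. by move=> y0 yb; rewrite -v0 v_incr// inJ// ltW. Qed.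

(** The hypothesis is the convexity of [v \o u^-1] on chords starting at
    [0], restricted to rational weights. *)
Lemma ratio_at_right_cvg :
  (forall z k n, 0 < z -> z <= b -> (k <= n.+1)%N ->
    exists m, [/\ J m, u m = k%:R / n.+1%:R * u z &
                  v m <= k%:R / n.+1%:R * v z]) ->
  cvg (v h / u h @[h --> 0^'+]).
Proof.
move=> chord; apply/cvg_ex; eexists.
apply: (@nondecreasing_at_right_cvgr _ _ 0 (BLeft b)) => //; last first.
  exists 0 => _ [y + <-]; rewrite /= in_itv/= => /andP[y0 /ltW yb].
  by apply: divr_ge0; apply/ltW; [exact: v_gt0|exact: u_gt0].
move=> y z; rewrite !in_itv/= => /andP[y0 /ltW yb] /andP[z0 /ltW zb].
rewrite le_eqVlt => /predU1P[->//|yz].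
have [uy uz vy vz] : [/\ 0 < u y, 0 < u z, 0 < v y & 0 < v z].
  by split; do ?[exact: u_gt0|exact: v_gt0].
have [yJ zJ] : y \in J /\ z \in J by split; apply: inJ; rewrite // ltW.
(* If the ratio were larger at [y] than at [z], a rational weight strictly between [u y / u z] and
   [v y / v z] would yield a point [m] with [u y < u m] and [v m < v y], although [u] and [v] both
   increase. *)
rewrite leNgt; apply/negP => lt_ratio.
have st : u y / u z < v y / v z.
  by move: lt_ratio; rewrite !ltr_pdivrMr// mulrAC ltr_pdivlMr// mulrC
    mulrAC ltr_pdivlMr// mulrC [v y * _]mulrC.
have [|||k [n [kn /andP[sr rt]]]] :=
  @fraction_between R (u y / u z) (v y / v z).
- by rewrite divr_ge0// ltW.
- by [].
- by rewrite ler_pdivrMr// mul1r ltW// v_incr.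
have [m [/mem_set Jm um vm]] := chord z k n z0 zb kn.
have : u y < u m by rewrite um -ltr_pdivrMr.
have : v m < v y by rewrite (le_lt_trans vm)// -ltr_pdivlMr.
case: (ltgtP m y) => [my|ym|->]; last by rewrite ltxx.
- by move=> _; rewrite ltNge ltW// u_incr.
- by rewrite ltNge ltW// v_incr.
Qed.

Lemma increasing_near_neq0 : \forall h \near 0^'+, u h != 0.
Proof.
near=> h; rewrite gt_eqF// u_gt0//.
apply: ltW; near: h; exact: nbhs_right_lt.
Unshelve. all: by end_near. Qed.

End RatioLimit.

Lemma middle_slope_cvg (R : realType) (u v w : R -> R) (a c : R) :
  (\forall h \near 0^'+, u h != 0) -> (\forall h \near 0^'+, v h != 0) ->
  cvg (v h / u h @[h --> 0^'+]) -> cvg (w h / v h @[h --> 0^'+]) ->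
  h^-1 * u h @[h --> 0^'+] --> a -> h^-1 * w h @[h --> 0^'+] --> c ->
  c != 0 -> exists2 d, d != 0 & h^-1 * v h @[h --> 0^'+] --> d.
Proof.
(* Near 0 the slope of [q] is the ratio [q h / p h] times the slope of [p]; this is used for [u],
   [v] and then for [v], [w], so that [c = l' * (l * a)]. *)
have chain (p q : R -> R) (l m : R) :
    (\forall h \near 0^'+, p h != 0) ->
    q h / p h @[h --> 0^'+] --> l -> h^-1 * p h @[h --> 0^'+] --> m ->
    h^-1 * q h @[h --> 0^'+] --> l * m.
  move=> p0 qp pm; apply: cvg_trans (cvgM qp pm); apply: near_eq_cvg.
  near=> h; have ph : p h != 0 by near: h.
  by rewrite /= [LHS]mulrCA divfK.
move=> u0 v0 /cvg_ex[l vu] /cvg_ex[l' wv] ua wc c0.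
have vla := chain _ _ _ _ u0 vu ua.
exists (l * a) => //; apply: contra_neq c0 => la0.
have := chain _ _ _ _ v0 wv vla.
by rewrite la0 mulr0 => /(cvg_lim (@Rhausdorff R)) <-; rewrite (cvg_lim _ wc).
Unshelve. all: by end_near. Qed.

(** * One-sided derivatives as limits at 0 from the right *)

(** For [s = -1] both argument and value are reflected: increasing functions keep increasing
    increments, and division by [h] still gives the difference quotient between [x] and
    [x + s * h]. *)
Definition increment {R : realType} (s : R) (f : R -> R) (x h : R) : R :=
  s * (f (x + s * h) - f x).

(** One-sided differentiability with nonzero derivative: on the right for
    [s = 1], on the left for [s = -1]. *)
Definition side_smooth {R : realType} (s : R) (f : R -> R) (x : R) : Prop :=
  exists2 a, a != 0 & h^-1 * increment s f x h @[h --> 0^'+] --> a.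

Lemma side_smoothZ (R : realType) (s e : R) (f : R -> R) (x : R) : e != 0 ->
  side_smooth s f x -> side_smooth s (fun y => e * f y) x.
Proof.
move=> e0 [a a0 fa]; exists (e * a); first by rewrite mulf_neq0.
rewrite [X in X @ _](_ : _ = fun h => e * (h^-1 * increment s f x h)).
  by apply: cvgM fa; apply: cvg_cst.
by apply/funext => h; rewrite /increment; ring.
Qed.

Lemma right_smoothP (R : realType) (f : R -> R) (x : R) :
  right_derivable f x /\ right_derive f x != 0 <-> side_smooth 1 f x.
Proof.
have E : (fun h => h^-1 * increment 1 f x h) =
         (fun h => h^-1 * (f (x + h) - f x)).
  by apply/funext => h; rewrite /increment !mul1r.
rewrite /side_smooth E.
split=> [[fx ?]|[a a0 fa]]; first by exists (right_derive f x).
split; first by apply/cvg_ex; exists a.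
by rewrite /right_derive (cvg_lim _ fa).
Qed.

Lemma left_smoothP (R : realType) (f : R -> R) (x : R) :
  left_derivable f x /\ left_derive f x != 0 <-> side_smooth (-1) f x.
Proof.
have flip (a : R) : (h^-1 * increment (-1) f x h @[h --> 0^'+] --> a) <->
              (h^-1 * (f (x + h) - f x) @[h --> 0^'-] --> a).
  apply: iff_sym; apply: (iff_trans (cvg_at_leftNP _ _ _)); rewrite oppr0.
  rewrite (_ : (fun h => h^-1 * increment _ _ _ h) =
               (fun h => h^-1 * (f (x + h) - f x)) \o -%R)//.
  by apply/funext => h; rewrite /increment /= invrN !mulN1r mulrN mulNr.
split=> [[fx ?]|[a a0 /flip fa]].
  by exists (left_derive f x) => //; apply/flip.
split; first by apply/cvg_ex; exists a.
by rewrite /left_derive (cvg_lim _ fa).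
Qed.

(** * Means through increasing generators *)

(** This stands in for [qa_mean] without a partial inverse: [f] is injective on [I], so the equation
    determines [A]. A decreasing generator is first multiplied by -1. *)
Definition averages {R : realType} {I : set R} (f : R -> R) (A : mean I) :
    Prop :=
  {in I &, {homo f : x y / x < y}} /\
  forall n (a : n.+1.-tuple I),
    f (set_val (A n a)) = (\sum_(i < n.+1) f (set_val (tnth a i))) / n.+1%:R.

Lemma qa_mean_averages (R : realType) (I : set R) (f : R -> R) :
  is_interval I -> generator I f ->
  exists2 e : R, e != 0 & averages (fun x => e * f x) (@qa_mean R I f).
Proof.
move=> Iitv fG; have avg e n (a : n.+1.-tuple I) :
    e * f (set_val (qa_mean f a)) =
    (\sum_(i < n.+1) e * f (set_val (tnth a i))) / n.+1%:R.
  by rewrite qa_meanE// mulrA mulr_sumr.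
have [_ [fi|fd]] := fG.
- exists 1; [exact: oner_neq0|split=> // x y xI yI xy].
  by rewrite !mul1r fi.
- exists (-1); [by rewrite oppr_eq0 oner_neq0|split=> // x y xI yI xy].
  by rewrite !mulN1r ltrN2 fd.
Qed.

(** Both points are means of one sample, [k] copies of [z] and the rest copies of [x]: [p] is its
    mean under [A], [q] under [B]. *)
Lemma averages_weighted (R : realType) (I : set R) (f g : R -> R) (A B : mean I)
    (x z : R) (k n : nat) :
  averages f A -> averages g B -> mean_le A B -> I x -> I z -> (k <= n.+1)%N ->
  exists p q, [/\ I p, I q, p <= q,
    f p = f x + k%:R / n.+1%:R * (f z - f x) &
    g q = g x + k%:R / n.+1%:R * (g z - g x)].
Proof.
move=> [_ fA] [_ gB] AB Ix Iz kn.
pose X : I := SigSub (mem_set Ix); pose Z : I := SigSub (mem_set Iz).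
pose a := [tuple if (i < k)%N then Z else X | i < n.+1].
have avg (c : R -> R) : (\sum_(i < n.+1) c (set_val (tnth a i))) / n.+1%:R =
    c x + k%:R / n.+1%:R * (c z - c x).
  have -> : \sum_(i < n.+1) c (set_val (tnth a i)) =
      \sum_(i < n.+1) (c x + (i < k)%:R * (c z - c x)).
    apply: eq_bigr => i _; rewrite tnth_mktuple.
    by case: ifP => _; rewrite ?mul1r ?mul0r ?addr0 ?subrKC.
  rewrite big_split/= sumr_const card_ord -mulr_suml.
  have -> : \sum_(i < n.+1) (i < k)%:R = k%:R :> R.
    rewrite -natr_sum; congr _%:R.
    by rewrite -big_mkcond/= -(big_ord_widen _ (fun=> 1%N) kn) sum1_card
       card_ord.
  by rewrite mulrDl -[c x *+ _]mulr_natr mulfK ?pnatr_eq0// mulrAC.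
exists (set_val (A n a)), (set_val (B n a)).
by split; rewrite ?fA ?gB ?avg//; apply/set_mem/valP.
Qed.

(** * Chord inequalities on either side of [x] *)

Section Side.
Context {R : realType} (I : set R) (s x b : R).
Hypotheses (Iitv : is_interval I) (Ix : I x) (s1 : s = 1 \/ s = -1).
Hypotheses (b0 : 0 < b) (Ib : I (x + s * b)).

Let J := [set h | I (x + s * h)].

Let bJ : [set` `[0, b]] `<=` J.
Proof.
move=> h; rewrite /= in_itv/= => /andP[h0 hb].
rewrite /J /=; move: Ib; case: s1 => -> Ib';
  [apply: Iitv Ix Ib' _ _|apply: Iitv Ib' Ix _ _];
  by apply/andP; split; lra.
Qed.

Let increment0 f : increment s f x 0 = 0.
Proof. by rewrite /increment mulr0 addr0 subrr mulr0. Qed.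

Let increment_homo f : {in I &, {homo f : y z / y < z}} ->
  {in J &, {homo increment s f x : y z / y < z}}.
Proof.
move=> fi y z /set_mem + /set_mem + yz.
rewrite /J /increment /=; case: s1 => -> /mem_set yI /mem_set zI.
- by rewrite ltr_pM2l// ltrD2r fi//; lra.
- by rewrite ltr_nM2l ?ltrN10// ltrD2r fi//; lra.
Qed.

Lemma increment_near_neq0 (f : R -> R) : {in I &, {homo f : y z / y < z}} ->
  \forall h \near 0^'+, increment s f x h != 0.
Proof. by move=> /increment_homo /(increasing_near_neq0 b0 bJ); apply. Qed.

(** The factor [s] reverses the chord inequality on the left: convexity is asked for [s = 1],
    concavity for [s = -1], and the increments satisfy the same chord bound in both cases. *)
Lemma increment_ratio_cvg (f g : R -> R) :
  {in I &, {homo f : y z / y < z}} -> {in I &, {homo g : y z / y < z}} ->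
  (forall z k n, I z -> (k <= n.+1)%N ->
    exists p, [/\ I p, f p = f x + k%:R / n.+1%:R * (f z - f x) &
      s * (g p - g x) <= s * (k%:R / n.+1%:R * (g z - g x))]) ->
  cvg (increment s g x h / increment s f x h @[h --> 0^'+]).
Proof.
move=> /increment_homo fi /increment_homo gi chord.
have ss : s * s = 1 by case: s1 => ->; rewrite ?mulr1// mulrNN mulr1.
apply: (ratio_at_right_cvg b0 bJ fi _ gi) => // z k n z0 zb kn.
have Iz : I (x + s * z) by apply: bJ; rewrite /= in_itv/= (ltW z0).
have [p [Ip fp gp]] := chord _ k n Iz kn.
have xp : x + s * (s * (p - x)) = p by rewrite mulrA ss; ring.
exists (s * (p - x)); rewrite /J /= /increment xp; split=> //.
- by rewrite fp; ring.
- by rewrite mulrCA.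
Qed.

End Side.

Section Comparison.
Context {R : realType} (I : set R) (x b : R) (f g : R -> R) (A B : mean I).
Hypotheses (Iitv : is_interval I) (Ix : I x) (b0 : 0 < b).
Hypotheses (fA : averages f A) (gB : averages g B) (AB : mean_le A B).

Let le_incr (h : R -> R) p q : {in I &, {homo h : y z / y < z}} ->
  I p -> I q -> p <= q -> h p <= h q.
Proof.
move=> hi /mem_set Ip /mem_set Iq; rewrite le_eqVlt => /predU1P[->//|pq].
by rewrite ltW// hi.
Qed.

Lemma right_ratio_cvg : I (x + 1 * b) ->
  cvg (increment 1 g x h / increment 1 f x h @[h --> 0^'+]).
Proof.
move=> Ib; apply: (increment_ratio_cvg Iitv Ix _ b0 Ib fA.1 gB.1).
  by left.
move=> z k n Iz kn.
have [p [q [Ip Iq pq fp gq]]] := averages_weighted fA gB AB Ix Iz kn.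
exists p; split=> //; rewrite !mul1r lerBlDl -gq; exact: (le_incr gB.1).
Qed.

Lemma left_ratio_cvg : I (x + -1 * b) ->
  cvg (increment (-1) f x h / increment (-1) g x h @[h --> 0^'+]).
Proof.
move=> Ib; apply: (increment_ratio_cvg Iitv Ix _ b0 Ib gB.1 fA.1).
  by right.
move=> z k n Iz kn.
have [p [q [Ip Iq pq fp gq]]] := averages_weighted fA gB AB Ix Iz kn.
(* The witness is now the larger mean [q]: there [g] takes its weighted value exactly and [f] at
   least its own. *)
exists q; split=> //; rewrite !mulN1r lerN2 lerBrDl -fp; exact: (le_incr fA.1).
Qed.

End Comparison.

(** * Smoothness of the middle mean *)

Lemma side_smooth_means_interval (R : realType) (I : set R) (s x b : R)
    (f g h : R -> R) :
  is_interval I -> I x -> 0 < b -> I (x + s * b) -> s = 1 \/ s = -1 ->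
  generator I f -> generator I g -> generator I h ->
  mean_le (@qa_mean R I f) (qa_mean h) ->
  mean_le (@qa_mean R I h) (qa_mean g) ->
  side_smooth s f x -> side_smooth s g x -> side_smooth s h x.
Proof.
move=> Iitv Ix b0 Ib s1 fG gG hG fh hg.
have [e e0 eA] := qa_mean_averages Iitv fG.
have [e' e'0 eB] := qa_mean_averages Iitv gG.
have [d d0 dM] := qa_mean_averages Iitv hG.
move=> /(side_smoothZ e0)[a a0 fa] /(side_smoothZ e'0)[c c0 gc].
have neq0 k (C : mean I) : averages k C ->
    \forall h \near 0^'+, increment s k x h != 0.
  by move=> [ki _]; apply: (increment_near_neq0 Iitv Ix s1 b0 Ib ki).
have /(side_smoothZ (invr_neq0 d0)) : side_smooth s (fun y => d * h y) x.
  case: s1 neq0 Ib fa gc => -> neq0 Ib fa gc.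
  - apply: (middle_slope_cvg (neq0 _ _ eA) (neq0 _ _ dM) _ _ fa gc c0).
    + exact: (right_ratio_cvg Iitv Ix b0 eA dM fh Ib).
    + exact: (right_ratio_cvg Iitv Ix b0 dM eB hg Ib).
  (* On the left the chain of ratios runs from [g] through [h] to [f], so the nonzero slope of [f]
     is the one that excludes a zero slope of [h]. *)
  - apply: (middle_slope_cvg (neq0 _ _ eB) (neq0 _ _ dM) _ _ gc fa a0).
    + exact: (left_ratio_cvg Iitv Ix b0 dM eB hg Ib).
    + exact: (left_ratio_cvg Iitv Ix b0 eA dM fh Ib).
by under [X in side_smooth _ X]eq_fun do rewrite mulKf//.
Qed.

Theorem corollary4 (R : realType) (I : set R) (x0 : R)
    (hI : is_interval I) (hx0 : I x0) :
  (x0%:E <> ereal_sup (EFin @` I) -> interval_type (right_smooth_means I x0)) /\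
  (x0%:E <> ereal_inf (EFin @` I) -> interval_type (left_smooth_means I x0)).
Proof.
split=> x0_end; split.
- by move=> _ [f [fG _ _ ->]]; exists f.
- move=> _ _ _ [f [fG fd f0 ->]] [g [gG gd g0 ->]] [h hG ->] fh hg.
  (* Otherwise [x0] would be an upper bound of [I] lying in [I], hence its supremum. *)
  have [y [Iy xy]] : exists y, I y /\ x0 < y.
    apply: contrapT => noy; apply: x0_end; apply/eqP; rewrite eq_le.
    rewrite ereal_sup_ubound/=; last by exists x0.
    apply/ereal_supP => _ [y Iy <-]; rewrite lee_fin leNgt.
    by apply/negP => xy; apply: noy; exists y.
  have Ib : I (x0 + 1 * (y - x0)) by rewrite mul1r addrC subrK.
  have /right_smoothP[hd h0] : side_smooth 1 h x0.
    apply: (side_smooth_means_interval hI hx0 _ Ib _ fG gG hG fh hg).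
    + by rewrite subr_gt0.
    + by left.
    + exact/right_smoothP.
    + exact/right_smoothP.
  by exists h.
- by move=> _ [f [fG _ _ ->]]; exists f.
- move=> _ _ _ [f [fG fd f0 ->]] [g [gG gd g0 ->]] [h hG ->] fh hg.
  have [y [Iy xy]] : exists y, I y /\ y < x0.
    apply: contrapT => noy; apply: x0_end; apply/eqP; rewrite eq_le.
    rewrite ereal_inf_lbound ?andbT/=; last by exists x0.
    apply/ereal_infP => _ [y Iy <-]; rewrite lee_fin leNgt.
    by apply/negP => xy; apply: noy; exists y.
  have Ib : I (x0 + -1 * (x0 - y)) by rewrite mulN1r opprB addrC subrK.
  have /left_smoothP[hd h0] : side_smooth (-1) h x0.
    apply: (side_smooth_means_interval hI hx0 _ Ib _ fG gG hG fh hg).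
    + by rewrite subr_gt0.
    + by right.
    + exact/left_smoothP.
    + exact/left_smoothP.
  by exists h.
Qed.
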